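(* Let $\{x_1,\dots,x_n\}$ be a linearly independent system of vectors in $H$ and $M:=\operatorname{span}\{x_1,\dots,x_n\}$. If $\gamma_i,\Gamma_i\in\mathbb{K}$, $i\in\{1,\dots,n\}$, are scalars and $x\in H\setminus M^{\perp}$ is such that $$\operatorname{Re}\left\langle\sum_{i=1}^n\Gamma_ix_i-x,\;x-\sum_{i=1}^n\gamma_ix_i\right\rangle\ge0,$$ then $$d^2(x,M)\le\frac14\left\|\sum_{i=1}^n(\Gamma_i-\gamma_i)x_i\right\|^2,$$ or, equivalently, $$\Gamma(x_1,\dots,x_n,x)\le\frac14\left\|\sum_{i=1}^n(\Gamma_i-\gamma_i)x_i\right\|^2\Gamma(x_1,\dots,x_n).$$
   Context: $(H;\langle\cdot,\cdot\rangle)$ is an inner product space over the real or complex number field $\mathbb{K}$, with norm $\|x\|=\langle x,x\rangle^{1/2}$. $M^{\perp}$ is the orthogonal complement of $M$ in $H$, and $d(x,M)=\inf_{y\in M}\|x-y\|$ is the distance from $x$ to $M$. For vectors $y_1,\dots,y_m\in H$, $\Gamma(y_1,\dots,y_m)$ denotes the Gram determinant, i.e. the determinant of the $m\times m$ matrix whose $(i,j)$-entry is $\langle y_i,y_j\rangle$; it is not to be confused with the scalars $\Gamma_i$. *)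

(* Defs.v *)
From mathcomp Require Import all_boot all_order all_algebra.
From mathcomp Require Import complex.
From mathcomp Require Import classical_sets reals.

Set Implicit Arguments.
Unset Strict Implicit.
Unset Printing Implicit Defensive.

Import Order.TTheory GRing.Theory Num.Theory.

Local Open Scope classical_set_scope.
Local Open Scope ring_scope.

Inductive scalar_kind := RealScalars | ComplexScalars.

(* On R[i] the order of a numFieldType is partial: z <= w holds iff w - z is a
   nonnegative real. *)
Definition scalars (R : realType) (k : scalar_kind) : numFieldType :=
  match k with
  | RealScalars => R
  | ComplexScalars => R[i]
  end.

Definition scal_conj (R : realType) (k : scalar_kind) :
    {rmorphism scalars R k -> scalars R k} :=
  match k with
  | RealScalars => idfun
  | ComplexScalars => @conjc R
  end.

Definition scal_re (R : realType) (k : scalar_kind) : scalars R k -> R :=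
  match k with
  | RealScalars => fun a => a
  | ComplexScalars => fun z => complex.Re z
  end.

Definition scal_of_real (R : realType) (k : scalar_kind) : R -> scalars R k :=
  match k with
  | RealScalars => fun a => a
  | ComplexScalars => fun a => a%:C%C
  end.
Arguments scal_of_real {R} k.

(* {dot H for scal_conj R k}: positive definite hermitian forms on H, linear in the
   first argument and conjugate-linear in the second. *)
Section InnerProduct.
Variables (R : realType) (k : scalar_kind).
Local Notation K := (scalars R k).
Variables (H : lmodType K) (ip : {dot H for scal_conj R k}).

Definition ipnorm (x : H) : R := Num.sqrt (scal_re (ip x x)).

Definition orthocompl (M : set H) : set H :=
  [set x | forall y, M y -> ip x y = 0].

Definition dist (x : H) (M : set H) : R := inf [set ipnorm (x - y) | y in M].

Definition gram (m : nat) (y : m.-tuple H) : K :=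
  \det (\matrix_(i < m, j < m) ip (tnth y i) (tnth y j)).

End InnerProduct.

Section Families.
Variables (K : fieldType) (H : lmodType K) (n : nat).

Definition lincomb (a : 'I_n -> K) (x : n.-tuple H) : H :=
  \sum_(i < n) a i *: tnth x i.

Definition lin_indep (x : n.-tuple H) : Prop :=
  forall a : 'I_n -> K, lincomb a x = 0 -> forall i, a i = 0.

Definition lin_span (x : n.-tuple H) : set H := [set lincomb a x | a in setT].

End Families.

(* Main.v *)
(** Put [u = sum Gam_i x_i] and [v = sum gam_i x_i]. The polarization identity
    gives [|x - (u + v)/2|^2 = 1/4 |u - v|^2 - Re <u - x, x - v>], and
    [(u + v)/2] lies in [M], whence the bound on [d(x, M)].

    For the equivalence, let [q] be the component of [x] orthogonal to [M].
    Then [d(x, M) = |q|], and row operations turn the last row of the Gram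
    matrix of [x_1, ..., x_n, x] into [0, ..., 0, |q|^2], so that
    [Gram(x_1, ..., x_n, x) = Gram(x_1, ..., x_n) d(x, M)^2]. The same identity
    shows, by induction, that the Gram determinant of an independent family is
    positive. *)
Require Import Defs.
From mathcomp Require Import all_boot all_order all_algebra.
From mathcomp Require Import complex.
From mathcomp Require Import classical_sets reals.
From mathcomp Require Import lra.
Set Implicit Arguments.
Unset Strict Implicit.
Unset Printing Implicit Defensive.
Import Order.TTheory GRing.Theory Num.Theory.
Local Open Scope ring_scope.

Lemma widen_ord_lift_max n (i : 'I_n) : widen_ord (leqnSn n) i = lift ord_max i.
Proof. by apply: val_inj; rewrite /= /bump leqNgt ltn_ord. Qed.

Section GramDeterminant.
Variables (K : numFieldType) (theta : {rmorphism K -> K}) (H : lmodType K).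
Variable ip : {dot H for theta}.

Lemma dot_ge0 u : 0 <= ip u u.
Proof.
have [->|u_neq0] := eqVneq u 0; first by rewrite linear0r.
by apply: ltW; apply: neq0_dnorm_gt0.
Qed.

Lemma dot_ortho_le (q m : H) : ip q m = 0 -> ip q q <= ip (q + m) (q + m).
Proof. by move=> qm0; rewrite hnormDd // lerDl dot_ge0. Qed.

Lemma dot_sumZl (I : finType) (a : I -> K) (z : I -> H) w :
  ip (\sum_i a i *: z i) w = \sum_i a i * ip (z i) w.
Proof. by rewrite linear_sumlz; apply: eq_bigr => i _; rewrite linearZl_LR. Qed.

Lemma dot_sumZr (I : finType) (a : I -> K) (z : I -> H) w :
  (forall i, ip w (z i) = 0) -> ip w (\sum_i a i *: z i) = 0.
Proof.
move=> wz0; rewrite linear_sumr big1 // => i _.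
by rewrite linearZr_LR /= wz0 mulr0.
Qed.

(** Families are functions here, so dropping the last vector is composition with [lift ord_max]. *)
Definition gram_mx n (z : 'I_n -> H) : 'M[K]_n :=
  \matrix_(i, j) ip (z i) (z j).

Definition independent n (z : 'I_n -> H) : Prop :=
  forall a : 'I_n -> K, \sum_i a i *: z i = 0 -> forall i, a i = 0.

Lemma det_gram_mx_last n (z : 'I_n.+1 -> H) (c : 'I_n -> K) :
  let q := z ord_max - \sum_i c i *: z (lift ord_max i) in
  (forall i, ip q (z (lift ord_max i)) = 0) ->
  \det (gram_mx z) = \det (gram_mx (z \o lift ord_max)) * ip q q.
Proof.
move=> q qz0.
(* [L] is the identity except for its last row [(-c, 1)]. It is lower unitriangular, and multiplying
   by it puts [q] in place of [z ord_max] in the last row of the Gram matrix. *)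
pose L : 'M[K]_n.+1 := \matrix_(i, j)
  if i == ord_max then oapp (fun k => - c k) 1 (unlift ord_max j)
  else (i == j)%:R.
have detL : \det L = 1.
  rewrite det_trig.
    rewrite big1 // => i _; rewrite mxE eqxx.
    by case: eqP => // ->; rewrite unlift_none.
  apply/is_trig_mxP => i j ltij; rewrite mxE.
  case: eqP => [i_max|_].
    by move: ltij; rewrite i_max ltnNge -ltnS ltn_ord.
  by case: eqP ltij => // ->; rewrite ltnn.
have LG_last j : (L *m gram_mx z) ord_max j = ip q (z j).
  rewrite mxE big_ord_recr /= mxE eqxx unlift_none /= mul1r mxE addrC.
  rewrite /q linearBl /= dot_sumZl -sumrN; congr (_ + _).
  apply: eq_bigr => i _; rewrite widen_ord_lift_max !mxE eqxx.
  by rewrite liftK /= mulNr.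
have LG_lift i j : (L *m gram_mx z) (lift ord_max i) j
    = ip (z (lift ord_max i)) (z j).
  rewrite mxE (bigD1 (lift ord_max i)) //= !mxE eqxx.
  rewrite eq_sym (negbTE (neq_lift _ _)) mul1r big1 ?addr0 // => k ki.
  by rewrite mxE eq_sym (negbTE (neq_lift _ _)) eq_sym (negbTE ki) mul0r.
rewrite -[LHS]mul1r -detL -det_mulmx (expand_det_row _ ord_max).
rewrite big_ord_recr /= big1 ?add0r => [|i _]; last first.
  by rewrite LG_last widen_ord_lift_max qz0 mul0r.
(* The cofactor sign has the even exponent [n + n]. *)
rewrite LG_last mulrC /cofactor -signr_odd oddD addbb mul1r.
congr (\det _ * _).
  by apply/matrixP => i j; rewrite !mxE -LG_lift mxE.
by rewrite [in RHS]/q linearBr /= dot_sumZr ?subr0.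
Qed.

(** The orthogonality conditions are the normal equations [c *m gram_mx z = b], solvable because the
    Gram matrix is invertible. *)
Lemma exists_ortho_component n (z : 'I_n -> H) (x : H) :
  \det (gram_mx z) != 0 ->
  exists c : 'I_n -> K, forall j, ip (x - \sum_i c i *: z i) (z j) = 0.
Proof.
move=> detz; pose b := \row_j ip x (z j).
exists (fun i => (b *m invmx (gram_mx z)) 0 i) => j.
rewrite linearBl /= dot_sumZl.
have <- : (b *m invmx (gram_mx z) *m gram_mx z) 0 j
    = \sum_i (b *m invmx (gram_mx z)) 0 i * ip (z i) (z j).
  by rewrite mxE; apply: eq_bigr => i _; congr (_ * _); rewrite mxE.
by rewrite mulmxKV ?unitmxE ?unitfE // mxE subrr.
Qed.

(** Over [R[i]] positivity includes being real, which is what allows the Gram determinant to be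
    cancelled from an inequality. *)
Lemma det_gram_mx_gt0 n (z : 'I_n -> H) :
  independent z -> 0 < \det (gram_mx z).
Proof.
elim: n z => [|n IHn] z z_indep; first by rewrite det_mx00 ltr01.
have z_indep_split (a : 'I_n -> K) b :
    \sum_i a i *: z (lift ord_max i) + b *: z ord_max = 0 ->
    (forall i, a i = 0) /\ b = 0.
  pose a' j := oapp a b (unlift ord_max j) => ab0.
  have a'0 : forall j, a' j = 0.
    apply: z_indep; rewrite -[RHS]ab0 big_ord_recr /= /a' unlift_none.
    congr (_ + _).
    by apply: eq_bigr => i _; rewrite widen_ord_lift_max liftK.
  split=> [i|]; first by have := a'0 (lift ord_max i); rewrite /a' liftK.
  by have := a'0 ord_max; rewrite /a' unlift_none.
have gram'_gt0 : 0 < \det (gram_mx (z \o lift ord_max)).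
  apply: IHn => a a0 i.
  by have [|//] := z_indep_split a 0; rewrite scale0r addr0.
have [c c_ortho] := @exists_ortho_component _ _ (z ord_max) (lt0r_neq0 gram'_gt0).
rewrite (det_gram_mx_last c_ortho) mulr_gt0 //; apply: neq0_dnorm_gt0.
(* If [q] vanished, it would be a linear relation with coefficient 1 on the last vector. *)
apply/eqP => q0; have [|_ /eqP] := z_indep_split (fun i => - c i) 1.
  rewrite scale1r addrC -[RHS]q0; congr (_ + _).
  by rewrite -sumrN; apply: eq_bigr => i _; rewrite scaleNr.
by rewrite oner_eq0.
Qed.

End GramDeterminant.

Section Scalars.
Variables (R : realType) (k : scalar_kind).
Local Notation K := (scalars R k).
Implicit Types (a b : K) (r s : R).

Lemma scal_re0 : scal_re (0 : K) = 0.
Proof. by case: k. Qed.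

Lemma scal_reD a b : scal_re (a + b) = scal_re a + scal_re b.
Proof. by case: k a b => //= -[? ?] [? ?]. Qed.

Lemma scal_reB a b : scal_re (a - b) = scal_re a - scal_re b.
Proof. by apply/eqP; rewrite eq_sym subr_eq -scal_reD subrK. Qed.

Lemma scal_re_conj a : scal_re (scal_conj R k a) = scal_re a.
Proof. by case: k a => //= -[? ?]. Qed.

Lemma scal_re_natMl n a : scal_re (n%:R * a) = n%:R * scal_re a.
Proof.
rewrite !mulr_natl; elim: n => [|n IHn].
  by rewrite !mulr0n scal_re0.
by rewrite !mulrS scal_reD IHn.
Qed.

Lemma scal_re_le a b : a <= b -> scal_re a <= scal_re b.
Proof. by case: k a b => //= -[? ?] [? ?]; rewrite lecE => /andP[]. Qed.

(** In the partial order on [R[i]], a nonnegative element has zero imaginary part. *)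
Lemma scal_reK a : 0 <= a -> scal_of_real k (scal_re a) = a.
Proof. by case: k a => //= -[? ?]; rewrite lecE /= => /andP[/eqP->]. Qed.

Lemma scal_of_real_le r s : (scal_of_real k r <= scal_of_real k s) = (r <= s).
Proof. by case: k => //=; rewrite lecR. Qed.

End Scalars.

Section Distance.
Variables (R : realType) (k : scalar_kind) (H : lmodType (scalars R k)).
Variable ip : {dot H for scal_conj R k}.

Lemma scal_re_dot_ge0 u : 0 <= scal_re (ip u u).
Proof. by rewrite -(scal_re0 R k) scal_re_le ?dot_ge0. Qed.

Lemma ipnorm_sqr u : ipnorm ip u ^+ 2 = scal_re (ip u u).
Proof. by rewrite sqr_sqrtr ?scal_re_dot_ge0. Qed.

Lemma ipnorm_half_sqr u :
  ipnorm ip (2^-1 *: u) ^+ 2 = 4^-1 * ipnorm ip u ^+ 2.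
Proof.
(* Only the natural number 2 then has to pass through the conjugation. *)
have {2}-> : u = 2 *: (2^-1 *: u) by rewrite scalerA divff ?scale1r ?pnatr_eq0.
rewrite !ipnorm_sqr [in RHS]linearZl_LR [in RHS]linearZr_LR /= rmorph_nat.
by rewrite !scal_re_natMl; lra.
Qed.

(** The cross terms [ip a b] and [ip b a] are conjugate, hence have the same real part. *)
Lemma ipnorm_polarization a b :
  ipnorm ip (b - a) ^+ 2 = ipnorm ip (a + b) ^+ 2 - 4 * scal_re (ip a b).
Proof.
rewrite -(opprB a b) !ipnorm_sqr hnormN !linearBl !linearBr !linearDl !linearDr /=.
have -> : ip b a = scal_conj R k (ip a b) by rewrite hermC mul1r.
by rewrite !scal_reB !scal_reD scal_re_conj; lra.
Qed.

Local Open Scope classical_set_scope.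

Lemma dist_le (x y : H) (M : set H) : M y -> dist ip x M <= ipnorm ip (x - y).
Proof.
move=> My; apply: ge_inf; last by exists y.
(* A lower bound is required, since [inf] takes a default value on sets unbounded below. *)
by exists 0 => _ [w _ <-]; apply: sqrtr_ge0.
Qed.

Lemma dist_ge0 (x : H) (M : set H) : M !=set0 -> 0 <= dist ip x M.
Proof.
move=> [y My]; apply: lb_le_inf => [|_ [w _ <-]]; last exact: sqrtr_ge0.
by exists (ipnorm ip (x - y)), y.
Qed.

(** By Pythagoras applied to [x - y = (x - p) + (p - y)], no [y] in [M] is closer to [x] than
    [p]. *)
Lemma dist_ortho (x p : H) (M : set H) :
  M p -> (forall y, M y -> ip (x - p) (p - y) = 0) ->
  dist ip x M = ipnorm ip (x - p).
Proof.
move=> Mp ortho; apply/eqP; rewrite eq_le dist_le //=.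
apply: lb_le_inf; first by exists (ipnorm ip (x - p)), p.
move=> _ [y My <-]; rewrite ler_wsqrtr // scal_re_le //.
by rewrite -[x - y](subrKA p) dot_ortho_le ?ortho.
Qed.

End Distance.

Lemma gramE (R : realType) (k : scalar_kind) (H : lmodType (scalars R k))
    (ip : {dot H for scal_conj R k}) n (xs : n.-tuple H) :
  gram ip xs = \det (gram_mx ip (tnth xs)).
Proof. by []. Qed.

Lemma tnth_rcons_max (T : Type) n (xs : n.-tuple T) (x : T) :
  tnth (rcons_tuple xs x) ord_max = x.
Proof. by rewrite (tnth_nth x) /= nth_rcons size_tuple ltnn eqxx. Qed.

Lemma tnth_rcons_lift (T : Type) n (xs : n.-tuple T) (x : T) i :
  tnth (rcons_tuple xs x) (lift ord_max i) = tnth xs i.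
Proof.
rewrite -widen_ord_lift_max !(tnth_nth x) /= nth_rcons size_tuple.
by rewrite ltn_ord.
Qed.

(** The component of [x] orthogonal to the span serves twice: its norm is the distance, and its
    squared norm is the last factor of the Gram determinant. *)
Lemma gram_rcons (R : realType) (k : scalar_kind) (H : lmodType (scalars R k))
    (ip : {dot H for scal_conj R k}) n (xs : n.-tuple H) (x : H) :
  lin_indep xs ->
  gram ip (rcons_tuple xs x)
  = gram ip xs * scal_of_real k (dist ip x (lin_span xs) ^+ 2).
Proof.
move=> xs_indep.
have [c c_ortho] := @exists_ortho_component _ _ _ ip _ (tnth xs) x
  (lt0r_neq0 (det_gram_mx_gt0 ip xs_indep)).
have E : \sum_i c i *: tnth (rcons_tuple xs x) (lift ord_max i) = lincomb c xs.
  by apply: eq_bigr => i _; rewrite tnth_rcons_lift.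
rewrite !gramE (@det_gram_mx_last _ _ _ ip _ _ c) => [|i]; last first.
  by rewrite tnth_rcons_max tnth_rcons_lift E c_ortho.
rewrite tnth_rcons_max E (@dist_ortho _ _ _ ip x (lincomb c xs)); first last.
- by move=> _ [a _ <-]; rewrite linearBr /= /lincomb !dot_sumZr ?subrr.
- by exists c.
rewrite ipnorm_sqr scal_reK ?dot_ge0 //; congr (\det _ * _).
by apply/matrixP => i j; rewrite !mxE /= !tnth_rcons_lift.
Qed.

Theorem theorem6 (R : realType) (k : scalar_kind)
    (H : lmodType (scalars R k)) (ip : {dot H for scal_conj R k})
    (n : nat) (xs : n.-tuple H) (gam Gam : 'I_n -> scalars R k) (x : H) :
  let M := lin_span xs in
  let bound := 4^-1 * ipnorm ip (\sum_(i < n) (Gam i - gam i) *: tnth xs i) ^+ 2 in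
  lin_indep xs ->
  ~ orthocompl ip M x ->
  (0 <= scal_re (ip (\sum_(i < n) Gam i *: tnth xs i - x)
                (x - \sum_(i < n) gam i *: tnth xs i)) ->
   dist ip x M ^+ 2 <= bound)
  /\ (dist ip x M ^+ 2 <= bound <->
      gram ip (rcons_tuple xs x) <= scal_of_real k bound * gram ip xs).
Proof.
move=> M bound xs_indep _; split; last first.
  (* Both sides now carry the positive factor [gram ip xs], which cancels. *)
  rewrite gram_rcons // mulrC ler_pM2r ?scal_of_real_le //.
  exact: det_gram_mx_gt0.
set u := \sum_i Gam i *: _; set v := \sum_i gam i *: _ => re_ge0.
have diffE : \sum_(i < n) (Gam i - gam i) *: tnth xs i = (u - x) + (x - v).
  by rewrite subrKA -sumrB; apply: eq_bigr => i _; rewrite scalerBl.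
pose w := 2^-1 *: (u + v).
have Mw : M w.
  exists (fun i => 2^-1 * (Gam i + gam i)) => //.
  rewrite /lincomb /w -big_split scaler_sumr.
  by apply: eq_bigr => i _; rewrite -scalerA scalerDl.
(* This is half of [b - a] in the polarization identity with [a = u - x] and [b = x - v], while
   [a + b] is the vector in [bound]. *)
have xwE : x - w = 2^-1 *: ((x - v) - (u - x)).
  have -> : (x - v) - (u - x) = 2 *: x - (u + v).
    by rewrite opprB addrACA -opprD scaler_nat mulr2n [v + u]addrC.
  by rewrite scalerBr scalerA mulVf ?scale1r ?pnatr_eq0.
apply: (@le_trans _ _ (ipnorm ip (x - w) ^+ 2)).
  (* Squaring preserves the inequality because both sides are nonnegative; [w] witnesses that [M] is
     nonempty. *)
  by rewrite lerXn2r ?nnegrE ?sqrtr_ge0 ?dist_le ?dist_ge0 //; exists w.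
rewrite xwE ipnorm_half_sqr ipnorm_polarization /bound diffE.
lra.
Qed.
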